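(* Let $n\ge1$. For a connected graph $G$ with distinct vertex labels in $[n]$ we have $$Y_G=(-1)^{n-1}Z_G$$ where $Z_G$ is $\mathbf{x}$-positive. Consequently, for a graph $G$ with $k$ connected components and distinct vertex labels in $[n]$ we have $$Y_G=(-1)^{n-k}Z_G$$ where $Z_G$ is $\mathbf{x}$-positive. Therefore $Y_G$ is $\mathbf{x}$-positive if $n-k$ is even, and is $\mathbf{x}$-negative if $n-k$ is odd.
   Context: All graphs are finite and simple. A graph $G$ with distinct vertex labels in $[n]=\{1,\dots,n\}$ is a graph with $n$ vertices labelled bijectively by $1,\dots,n$; write $v_i$ for the vertex labelled $i$. Let $x_1,x_2,\dots$ be noncommuting variables. A proper colouring of $G$ is a map $\kappa$ from the vertices to $\{1,2,\dots\}$ with $\kappa(u)\ne\kappa(v)$ whenever $u,v$ are adjacent. The chromatic symmetric function in noncommuting variables is $Y_G=\sum_\kappa x_{\kappa(v_1)}\cdots x_{\kappa(v_n)}\in\mathbb{Q}\langle\langle x_1,x_2,\dots\rangle\rangle$, summed over all proper colourings $\kappa$ of $G$. Set partitions $\pi\vdash[n]$ are ordered by refinement ($\pi\le\sigma$ iff every block of $\pi$ is contained in a block of $\sigma$), giving the partition lattice $\Pi_n$ with Möbius function $\mu_\Pi$. For $\pi\vdash[n]$, $p_\pi=\sum x_{i_1}\cdots x_{i_n}$ over all tuples $(i_1,\dots,i_n)$ of positive integers with $i_j=i_k$ whenever $j,k$ are in the same block of $\pi$. The Schur function in noncommuting variables is $\mathbf{x}_\pi=\sum_{\sigma\le\pi}\mu_\Pi(\sigma,\pi)\,p_\sigma$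 (equivalently $p_\pi=\sum_{\sigma\le\pi}\mathbf{x}_\sigma$). For $n\ge1$, $\mathrm{NCSym}^n$ is the $\mathbb{Q}$-span of $\{p_\pi:\pi\vdash[n]\}$; both $\{p_\pi\}_{\pi\vdash[n]}$ and $\{\mathbf{x}_\pi\}_{\pi\vdash[n]}$ are bases of it, and $Y_G\in\mathrm{NCSym}^n$. An element $f=\sum_\pi c_\pi\mathbf{x}_\pi$ is $\mathbf{x}$-positive if $c_\pi\ge0$ for all $\pi$, and $\mathbf{x}$-negative if $c_\pi\le0$ for all $\pi$. *)

(* Defs.v *)
From HB Require Import structures.
From mathcomp Require Import all_boot all_order all_algebra.
From mathcomp Require Import boolp classical_sets functions cardinality fsbigop.

Set Implicit Arguments.
Unset Strict Implicit.
Unset Printing Implicit Defensive.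

Import Order.TTheory GRing.Theory Num.Theory.
Local Open Scope ring_scope.

(* [n] is 'I_n, and colours (hence variables x_1, x_2, ...) are indexed by nat:
   all indices are shifted down by one from the usual 1-based ones. *)

Record setpart (n : nat) := SetPart {
  blocks : {set {set 'I_n}};
  _ : finset.partition blocks [set: 'I_n]
}.
HB.instance Definition _ n := [isSub for @blocks n].
HB.instance Definition _ n := [Finite of setpart n by <:].

Definition refines n (P Q : setpart n) : bool :=
  [forall A in blocks P, [exists B in blocks Q, A \subset B]].

Lemma refinesP n (P Q : setpart n) :
  reflect (forall A, A \in blocks P -> exists2 B, B \in blocks Q & A \subset B)
          (refines P Q).
Proof.
apply: (iffP forall_inP) => PQ A /PQ; first by case/exists_inP=> B; exists B.
by case=> B BQ AB; apply/exists_inP; exists B.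
Qed.

Lemma refines_refl n : reflexive (@refines n).
Proof. by move=> P; apply/refinesP=> A AP; exists A. Qed.

Lemma refines_trans n : transitive (@refines n).
Proof.
move=> Q P S /refinesP PQ /refinesP QS; apply/refinesP=> A /PQ[B /QS[C CS BC] AB].
by exists C => //; apply: fintype.subset_trans BC.
Qed.

Lemma refines_sub n (P Q : setpart n) :
  refines P Q -> refines Q P -> {subset blocks P <= blocks Q}.
Proof.
move=> /refinesP PQ /refinesP QP A AP.
have [B BQ AB] := PQ _ AP; have [C CP BC] := QP _ BQ.
have /and3P[_ tP nP] := valP P.
suff eAC : A = C by rewrite (_ : A = B) //; apply/eqP; rewrite finset.eqEsubset AB eAC.
apply/eqP/negP=> /negP nAC.
have := finset.trivIsetP tP _ _ AP CP nAC; rewrite -finset.setI_eq0.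
rewrite (finset.setIidPl _) ?(fintype.subset_trans AB) // => /eqP A0.
by rewrite A0 (negPf nP) in AP.
Qed.

Lemma refines_anti n : antisymmetric (@refines n).
Proof.
move=> P Q /andP[PQ QP]; apply/val_inj/setP=> A.
by apply/idP/idP; apply: refines_sub.
Qed.

Fact setpart_display : Order.disp_t. Proof. exact: Order.Disp tt tt. Qed.

HB.instance Definition _ n := Order.Le_isPOrder.Build setpart_display (setpart n)
  (@refines_refl n) (@refines_anti n) (@refines_trans n).

(* The recursion mu(x, x) = 1, mu(x, y) = - \sum_(x <= z < y) mu(x, z) is run
   with fuel #|T|; mobiusE states that the fuel suffices. *)
Section Mobius.
Variables (d : Order.disp_t) (T : finPOrderType d).
Local Open Scope order_scope.

Fixpoint mobius_rec (k : nat) (x y : T) : int :=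
  if k is k'.+1 then
    if x == y then 1%R
    else if x < y then
      (- \sum_(z : T | (x <= z)%O && (z < y)%O) mobius_rec k' x z)%R
    else 0%R
  else 0%R.

Definition mobius : T -> T -> int := mobius_rec #|T|.

Lemma mobius_rec_fuel k l x y :
  (#|[pred z : T | (z <= y)%O]| <= k)%N ->
  (#|[pred z : T | (z <= y)%O]| <= l)%N ->
  mobius_rec k x y = mobius_rec l x y.
Proof.
have pos u : #|[pred z : T | (z <= u)%O]| <> 0%N.
  by move/card0_eq/(_ u); rewrite inE lexx.
elim: k l y => [|k IHk] [|l] y; try by rewrite leqn0 => /eqP /pos.
  by move=> _; rewrite leqn0 => /eqP /pos.
move=> hk hl /=; case: eqP => // _; case: ifP => // _; congr (- _)%R.
apply: eq_bigr => z /andP[_ zy].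
have lt_zy : (#|[pred u : T | (u <= z)%O]| < #|[pred u : T | (u <= y)%O]|)%N.
  apply: proper_card; apply/properP; split.
    by apply/fintype.subsetP=> u; rewrite !inE => /le_trans; apply; apply: ltW.
  by exists y; rewrite inE ?lexx // lt_geF.
by apply: IHk; rewrite -ltnS (leq_trans lt_zy).
Qed.

Lemma mobiusE x y : mobius x y =
  if x == y then 1%R
  else if x < y then (- \sum_(z : T | (x <= z)%O && (z < y)%O) mobius x z)%R
  else 0%R.
Proof.
rewrite [LHS](@mobius_rec_fuel #|T| #|T|.+1) ?max_card //.
by apply: leqW; apply: max_card.
Qed.

End Mobius.

(* A formal power series is its coefficient function on words. *)
Definition ncseries : Type := seq nat -> rat^o.
HB.instance Definition _ := GRing.Lmodule.copy ncseries (seq nat -> rat^o).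

Definition ncmonomial (u : seq nat) : ncseries := fun w => (w == u)%:R.

(* The possibly infinite sum \sum_(t in A) x_(m t), coefficientwise; each
   coefficient is a finite sum whenever m is injective on A. *)
Definition ncsum (T : choiceType) (A : set T) (m : T -> seq nat) : ncseries :=
  fun w => \sum_(t \in A) ncmonomial (m t) w.

Lemma ncsumE (T : choiceType) (A : set T) (m : T -> seq nat) (w : seq nat) :
  injective m -> ncsum A m w = `[< exists2 t, A t & m t = w >]%:R.
Proof.
move=> mI; rewrite /ncsum; case: asboolP => [[t At <-]|nA].
  rewrite -(@fsbig_widen _ _ _ _ [set t]%classic) => [|u ->//|u [_ /= ut]].
    by rewrite fsbig_set1 /ncmonomial eqxx.
  by rewrite /ncmonomial; case: eqP => // /mI tu; case: ut.
apply: fsbig1 => t At; rewrite /ncmonomial; case: eqP => // wt.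
by case: nA; exists t.
Qed.

Section Labelled.
Variables (n : nat) (V : finType) (e : rel V) (v : 'I_n -> V).

Definition proper_colouring (kappa : {ffun V -> nat}) : Prop :=
  forall a b, e a b -> kappa a <> kappa b.

Definition colour_word (kappa : {ffun V -> nat}) : seq nat :=
  [seq kappa (v i) | i <- enum 'I_n].

Definition Y : ncseries :=
  ncsum [set kappa | proper_colouring kappa]%classic colour_word.

Lemma colour_word_inj : bijective v -> injective colour_word.
Proof.
case=> g vK gK k1 k2 /eq_in_map k12; apply/ffunP=> a.
by rewrite -(gK a) k12 // mem_enum.
Qed.

End Labelled.

Definition connected_graph (V : finType) (e : rel V) : Prop :=
  (0 < #|V|)%N /\ forall a b, connect e a b.

Section NCSym.
Variable n : nat.
Implicit Types P Q : setpart n.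

Definition block_constant P (i : {ffun 'I_n -> nat}) : Prop :=
  forall B j k, B \in blocks P -> j \in B -> k \in B -> i j = i k.

Definition tuple_word (i : {ffun 'I_n -> nat}) : seq nat :=
  [seq i j | j <- enum 'I_n].

Lemma tuple_word_inj : injective tuple_word.
Proof. by move=> i1 i2 /eq_in_map i12; apply/ffunP=> j; rewrite i12 ?mem_enum. Qed.

Definition ncp P : ncseries :=
  ncsum [set i | block_constant P i]%classic tuple_word.

Definition ncx P : ncseries :=
  \sum_(Q : setpart n | (Q <= P)%O) (mobius Q P)%:~R *: ncp Q.

(* The ncx P are linearly independent, so c below is unique. *)
Definition x_positive (f : ncseries) : Prop :=
  exists c : setpart n -> rat,
    f = \sum_(P : setpart n) c P *: ncx P /\ forall P, 0 <= c P.

Definition x_negative (f : ncseries) : Prop :=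
  exists c : setpart n -> rat,
    f = \sum_(P : setpart n) c P *: ncx P /\ forall P, c P <= 0.

End NCSym.

(* Main.v *)
(* Deletion-contraction on the constraints of a colouring.  For lists of edges A
   and C let Y(A, C) enumerate the words that differ along the edges of A and
   agree along those of C.  Then Y(a :: A, C) = Y(A, C) - Y(A, a :: C), and
   Y([::], C) = p_pi = \sum_(sigma <= pi) x_sigma, where pi is the partition into
   components of C.  So the coefficient of x_sigma in Y(A, C) obeys the same
   recursion, and its sign is (-1)^(rank (A ++ C) - rank C) by induction on A:
   - if a joins two vertices linked by C, the two terms cancel;
   - if these are linked by A ++ C but not by C, both terms have the right sign;
   - if a is a bridge of a :: A ++ C, then the first term has the wrong sign, but
     either sigma is not below the components of A ++ C and this term vanishes,
     or a is irrelevant to sigma and the two terms cancel. *)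
Require Import Defs.
From mathcomp Require Import all_boot all_order all_algebra.
From mathcomp Require Import boolp classical_sets functions.
Import Order.TTheory GRing.Theory Num.Theory.
Local Open Scope ring_scope.

(** * Components of a list of edges, and the effect of adding one edge *)

Definition edge_rel {T : finType} (C : seq (T * T)) : rel T :=
  fun x y => ((x, y) \in C) || ((y, x) \in C).

Notation linked C := (connect (edge_rel C)).

Lemma linked_sym {T : finType} (C : seq (T * T)) : connect_sym (edge_rel C).
Proof. by apply: sym_connect_sym => x y; rewrite /edge_rel orbC. Qed.

Lemma eq_linked {T : finType} {C C' : seq (T * T)} :
  C =i C' -> linked C =2 linked C'.
Proof. by move=> eqC; apply: eq_connect => x y; rewrite /edge_rel !eqC. Qed.

Lemma linked_edge {T : finType} (C : seq (T * T)) (x y : T) :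
  (x, y) \in C -> linked C x y.
Proof. by move=> xy; apply: connect1; rewrite /edge_rel xy. Qed.

(** A path can be shortened to cross the new edge at most once; the induction extends the path at
    its far end. *)
Lemma linked_cons {T : finType} (u v : T) (C : seq (T * T)) (x y : T) :
  linked ((u, v) :: C) x y =
  [|| linked C x y, linked C x u && linked C v y
    | linked C x v && linked C u y].
Proof.
have sub a b : linked C a b -> linked ((u, v) :: C) a b.
  apply: connect_sub => {}a {}b; rewrite /edge_rel => /orP ab; apply: connect1.
  by rewrite /edge_rel !inE; case: ab => ->; rewrite !orbT.
have uv : linked ((u, v) :: C) u v by apply: linked_edge; rewrite inE eqxx.
have vu : linked ((u, v) :: C) v u by rewrite linked_sym.
apply/idP/or3P; last first.
  case=> [/sub //|/andP[/sub xu /sub vy]|/andP[/sub xv /sub uy]].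
    exact: connect_trans xu (connect_trans uv vy).
  exact: connect_trans xv (connect_trans vu uy).
case/connectP=> p pP -> {y}; elim/last_ind: p pP => [_|p z IHp]; first by constructor 1.
rewrite rcons_path last_rcons => /andP[/IHp {}IHp].
move: (last x p) IHp => y IHp; rewrite /edge_rel !inE !xpair_eqE -!orbA.
have step : linked C y z -> [\/ linked C x z, linked C x u && linked C v z
    | linked C x v && linked C u z].
  move=> yz; case: IHp => [xy|/andP[-> vy]|/andP[-> uy]].
  - by constructor 1; apply: connect_trans yz.
  - by constructor 2; apply: connect_trans yz.
  - by constructor 3; apply: connect_trans yz.
case/or4P => [/andP[/eqP yu /eqP zv]|yz|/andP[/eqP zu /eqP yv]|yz].
- rewrite {}yu {}zv {step} in IHp *.
  by case: IHp => [->|/andP[-> _]|/andP[-> _]]; rewrite ?connect0;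
    [constructor 2|constructor 2|constructor 1].
- by apply: step; apply: linked_edge.
- rewrite {}yv {}zu {step} in IHp *.
  by case: IHp => [->|/andP[-> _]|/andP[-> _]]; rewrite ?connect0;
    [constructor 3|constructor 1|constructor 3].
- by apply: step; rewrite linked_sym linked_edge.
Qed.

Lemma linked_cons_sub {T : finType} (u v : T) (B C : seq (T * T)) :
  linked B u v -> subrel (linked C) (linked B) ->
  subrel (linked ((u, v) :: C)) (linked B).
Proof.
move=> uv CB x y; rewrite linked_cons.
case/or3P=> [/CB //|/andP[/CB xu /CB vy]|/andP[/CB xv /CB uy]].
  exact: connect_trans xu (connect_trans uv vy).
by apply: connect_trans xv (connect_trans _ uy); rewrite linked_sym.
Qed.

Lemma linked_cons_id {T : finType} (u v : T) (C : seq (T * T)) :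
  linked C u v -> linked ((u, v) :: C) =2 linked C.
Proof.
move=> uv x y; apply/idP/idP; first exact: linked_cons_sub.
by rewrite linked_cons => ->.
Qed.

(* The roots for (u, v) :: C are the images of those for C other than the root
   of v. *)
Lemma n_comp_cons {T : finType} (u v : T) (C : seq (T * T)) :
  n_comp (edge_rel C) T =
  (~~ linked C u v + n_comp (edge_rel ((u, v) :: C)) T)%N.
Proof.
have [uv|nuv] := boolP (linked C u v).
  by rewrite (eq_n_comp (linked_cons_id _ _ _ uv)).
set e := edge_rel C; set e' := edge_rel _.
have eS : connect_sym e := linked_sym _.
have e'S : connect_sym e' := linked_sym _.
have rt a b : connect e' a b -> fingraph.root e' a = fingraph.root e' b.
  by move/(fingraph.rootP e'S).
have sub a b : connect e a b -> connect e' a b by move=> ab; rewrite /e' linked_cons -/e ab.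
pose R := [set x | roots e x]%SET.
have Rn : n_comp e T = #|R|.
  by rewrite /n_comp_mem; apply: eq_card => x; rewrite !inE andbT.
have Rv : fingraph.root e v \in R by rewrite inE roots_root.
rewrite Rn (cardsD1 (fingraph.root e v)) Rv; congr (_ + _)%N.
rewrite -(card_in_imset (f := fingraph.root e')); last first.
  move=> x y; rewrite !inE => /andP[xv xR] /andP[yv yR] /(fingraph.rootP e'S).
  rewrite /e' linked_cons -/e.
  (* A root other than that of [v] is not linked to [v] by [C], so the new edge cannot merge two
     such roots. *)
  have nv z : roots e z -> z != fingraph.root e v -> connect e z v = false.
    by move=> /eqP zR zv; apply: contraNF zv => /(fingraph.rootP eS) <-; rewrite zR.
  rewrite (nv x) // (eS v y) (nv y) // andbF !orbF.
  by move/(fingraph.rootP eS); rewrite (eqP xR) (eqP yR).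
rewrite /n_comp_mem; apply: eq_card => z; rewrite !inE andbT.
apply/imsetP/idP => [[x _ ->]|zR]; first by rewrite roots_root.
(* A new root [z] in the old class of [v] is the image of the root of [u], which differs from that
   of [v] because [C] does not link the two. *)
have [zv|nzv] := boolP (connect e z v).
  exists (fingraph.root e u).
    rewrite !inE roots_root // andbT; apply: contra nuv => /eqP.
    by move/(fingraph.rootP eS).
  rewrite -(eqP zR); apply: rt; apply: connect_trans (sub _ _ zv) _.
  apply: connect_trans (sub _ _ (connect_root e u)).
  by rewrite e'S; apply: linked_edge; rewrite inE eqxx.
exists (fingraph.root e z).
  by rewrite !inE roots_root // andbT; apply: contra nzv => /eqP /(fingraph.rootP eS).
by rewrite -[LHS](eqP zR); apply: rt; apply/sub/connect_root.
Qed.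

Lemma n_comp_nil {T : finType} : n_comp (edge_rel (Nil (T * T))) T = #|T|.
Proof.
apply: eq_card => x; rewrite !inE andbT; apply/eqP.
by case/connectP: (connect_root (edge_rel (Nil (T * T))) x) => -[].
Qed.

(** * Signs of the coefficients under deletion-contraction *)

Definition joins {T : finType} (D : rel T) (C : seq (T * T)) : bool :=
  [forall x, forall y, D x y ==> linked C x y].

Lemma joinsP {T : finType} {D : rel T} {C : seq (T * T)} :
  reflect (subrel D (linked C)) (joins D C).
Proof.
apply: (iffP forallP) => [DC x y Dxy|DC x].
  by move/forallP/(_ y)/implyP: (DC x); apply.
by apply/forallP=> y; apply/implyP/DC.
Qed.

(* For D = same_block sigma, the coefficient of x_sigma in Y(A, C). *)
Fixpoint chrom_coef {T : finType} (D : rel T) (A C : seq (T * T)) : rat :=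
  if A is a :: A' then chrom_coef D A' C - chrom_coef D A' (a :: C)
  else (joins D C)%:R.

(** The recursion consults [C] only through its components, so redundant edges and reorderings can
    be ignored. *)
Lemma eq_chrom_coef {T : finType} (D : rel T) (A C C' : seq (T * T)) :
  linked C =2 linked C' -> chrom_coef D A C = chrom_coef D A C'.
Proof.
elim: A C C' => [|[u v] A IHA] C C' eqC /=.
  congr (_%:R); congr nat_of_bool.
  by apply/joinsP/joinsP => DC x y /DC; rewrite eqC.
by congr (_ - _); apply: IHA => // x y; rewrite !linked_cons !eqC.
Qed.

(** At every leaf of the recursion the list consists of edges of [A] and [C], hence links nothing
    that [B] does not. *)
Lemma chrom_coef_eq0 {T : finType} (D : rel T) (A B C : seq (T * T)) :
  {in A, forall a, linked B a.1 a.2} -> subrel (linked C) (linked B) ->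
  ~~ joins D B -> chrom_coef D A C = 0.
Proof.
move=> AB CB nDB; elim: A AB C CB => [|[u v] A IHA] AB C CB /=.
  case: joinsP => // DC; case/negP: nDB; apply/joinsP=> x y /DC; exact: CB.
have {}IHA := IHA (fun a aA => AB a (mem_behead (s := _ :: A) aA)).
have uv : linked B u v by apply: (AB (u, v)); rewrite inE eqxx.
by rewrite !IHA ?subr0 //; apply: linked_cons_sub.
Qed.

(** At every leaf, the pairs of [D] lie inside components of [B], and an edge between two different
    components cannot help to link them. *)
Lemma chrom_coef_bridge {T : finType} (D : rel T) (u v : T) (A B C : seq (T * T)) :
  {in A, forall a, linked B a.1 a.2} -> subrel (linked C) (linked B) ->
  joins D B -> ~~ linked B u v ->
  chrom_coef D A ((u, v) :: C) = chrom_coef D A C.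
Proof.
move=> AB CB /joinsP DB nuv; elim: A AB C CB => [|[a b] A IHA] AB C CB /=.
  congr (_%:R); congr nat_of_bool.
  apply/joinsP/joinsP => DC x y Dxy; last by rewrite linked_cons DC.
  have xy := DB _ _ Dxy.
  have := DC _ _ Dxy; rewrite linked_cons => /or3P[//|/andP[xu vy]|/andP[xv uy]].
    case/negP: nuv; apply: connect_trans (_ : linked B u x) _.
      by rewrite linked_sym CB.
    by apply: connect_trans xy _; rewrite linked_sym CB.
  case/negP: nuv; apply: connect_trans (CB _ _ uy) _.
  by rewrite linked_sym; apply: connect_trans xy; rewrite linked_sym CB.
have {}IHA := IHA (fun e eA => AB e (mem_behead (s := _ :: A) eA)).
have ab : linked B a b by apply: (AB (a, b)); rewrite inE eqxx.
rewrite IHA // -(IHA ((a, b) :: C)); last exact: linked_cons_sub.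
congr (_ - _); apply: eq_chrom_coef; apply: eq_linked => e.
by rewrite !inE orbCA.
Qed.

(* The exponent is n_comp C - n_comp (A ++ C) up to parity. *)
Lemma chrom_coef_sign {T : finType} (D : rel T) (A C : seq (T * T)) :
  0 <= (-1) ^+ (n_comp (edge_rel C) T + n_comp (edge_rel (A ++ C)) T)
       * chrom_coef D A C.
Proof.
elim: A C => [|[u v] A IHA] C /=.
  by rewrite -signr_odd oddD addbb mul1r ler0n.
have [uv|nuv] := boolP (linked C u v).
  by rewrite (eq_chrom_coef _ _ _ _ (linked_cons_id _ _ _ uv)) subrr mulr0.
have AB : {in A, forall a, linked (A ++ C) a.1 a.2}.
  by case=> a b abA; apply: linked_edge; rewrite mem_cat abA.
have CB : subrel (linked C) (linked (A ++ C)).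
  apply: connect_sub => x y; rewrite /edge_rel => xy; apply: connect1.
  by rewrite /edge_rel !mem_cat; case/orP: xy => ->; rewrite !orbT.
have := IHA ((u, v) :: C).
have -> : n_comp (edge_rel (A ++ (u, v) :: C)) T
        = n_comp (edge_rel ((u, v) :: A ++ C)) T.
  apply: eq_n_comp; apply: eq_linked => a.
  by rewrite !(inE, mem_cat) orbCA.
have := IHA C.
rewrite (n_comp_cons u v C) nuv (n_comp_cons u v (A ++ C)).
have [uvB|nuvB] := boolP (linked (A ++ C) u v).
  (* Adding the edge removes a component of [C] but none of [A ++ C]: the parity changes for the
     second term only and absorbs its minus sign. *)
  rewrite add0n add1n addSn exprS mulN1r !mulNr mulrBr => c1_ge0 c2_ge0.
  by rewrite opprB addrC addr_ge0.
have [DB|nDB] := boolP (joins D (A ++ C)).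
  by rewrite (chrom_coef_bridge _ _ _ _ _ _ AB CB) // subrr mulr0.
rewrite (chrom_coef_eq0 _ _ _ _ AB CB nDB) sub0r => _.
by rewrite add1n addSn exprS mulN1r mulrNN.
Qed.

(** * Moebius inversion between the bases p and x *)

Lemma sum_mobius {d : Order.disp_t} {T : finPOrderType d} (x y : T) :
  \sum_(z : T | (x <= z)%O && (z <= y)%O) mobius x z = (x == y)%:R :> int.
Proof.
have [<-|nxy] := eqVneq x y.
  rewrite (big_pred1 x) => [|z]; first by rewrite mobiusE eqxx.
  by rewrite andbC -eq_le.
have [lexy|nle] := boolP (x <= y)%O; last first.
  by apply: big1 => z /andP[xz zy]; rewrite (le_trans xz zy) in nle.
(* By the recursion, the term at [y] is the opposite of the sum of the others. *)
rewrite (bigD1 y) /= ?lexy ?lexx // mobiusE (negPf nxy) lt_neqAle nxy lexy /=.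
apply/eqP; rewrite addrC subr_eq0; apply/eqP; apply: eq_bigl => z.
by rewrite lt_neqAle -andbA [(z <= y)%O && _]andbC.
Qed.

(** After exchanging the sums, the coefficient of [ncp R] is the sum of [mobius R Q] for [Q] between
    [R] and [P], which vanishes unless [R] is [P]. *)
Lemma ncp_sum {n : nat} (P : setpart n) : ncp P = \sum_(Q | (Q <= P)%O) ncx Q.
Proof.
rewrite (exchange_big_dep (fun R : setpart n => R <= P)%O) /=; last first.
  by move=> Q R QP RQ; apply: le_trans RQ QP.
rewrite (bigD1 P) //= [X in _ + X]big1 ?addr0 => [|R /andP[_ RP]].
  rewrite -scaler_suml -raddf_sum /=.
  under eq_bigl do rewrite andbC.
  by rewrite sum_mobius eqxx scale1r.
rewrite -scaler_suml -raddf_sum /=.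
under eq_bigl do rewrite andbC.
by rewrite sum_mobius (negPf RP) scale0r.
Qed.

(** * Set partitions and series attached to lists of edges *)

Definition same_block {n : nat} (P : setpart n) : rel 'I_n :=
  fun i j => [exists B in blocks P, (i \in B) && (j \in B)].

Lemma linked_partition {n : nat} (C : seq ('I_n * 'I_n)) :
  finset.partition (equivalence_partition (linked C) [set: 'I_n]%SET) [set: 'I_n]%SET.
Proof.
apply: equivalence_partitionP => x y z _ _ _; split; first exact: connect0.
by move=> /(same_connect (linked_sym C)).
Qed.

Definition linked_setpart {n : nat} (C : seq ('I_n * 'I_n)) : setpart n :=
  SetPart (linked_partition C).

Lemma le_linked_setpart {n : nat} (P : setpart n) (C : seq ('I_n * 'I_n)) :
  (P <= linked_setpart C)%O = joins (same_block P) C.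
Proof.
apply/refinesP/joinsP => [PC x y /exists_inP[B /PC[B' /imsetP[z _ ->] BB'] /andP[xB yB]]|PC A AP].
  have:= fintype.subsetP BB' _ xB. have:= fintype.subsetP BB' _ yB; rewrite !inE /= => zy zx.
  by apply: connect_trans zy; rewrite linked_sym.
have /and3P[_ _ nP] := valP P.
have /set0Pn[x xA] : A != finset.set0 by apply: contraNneq nP => <-.
exists [set y in [set: 'I_n] | linked C x y]%SET; first by apply: imset_f; rewrite inE.
apply/fintype.subsetP=> y yA; rewrite !inE; apply: PC; apply/exists_inP; exists A => //.
by rewrite xA.
Qed.

Definition edge_constraints {n : nat} (A C : seq ('I_n * 'I_n))
    (i : {ffun 'I_n -> nat}) : Prop :=
  {in A, forall a, i a.1 <> i a.2} /\ {in C, forall a, i a.1 = i a.2}.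

(** This is the Y(A, C) of the overview. *)
Definition constrained_series {n : nat} (A C : seq ('I_n * 'I_n)) : ncseries :=
  ncsum [set i | edge_constraints A C i]%classic (@tuple_word n).

(** Agreement along the edges of [C] propagates along paths, hence to whole components. *)
Lemma constrained_series_nil {n : nat} (C : seq ('I_n * 'I_n)) :
  constrained_series [::] C = ncp (linked_setpart C).
Proof.
congr (ncsum _ _); apply/seteqP; split => i /=.
  case=> _ iC B j k /imsetP[x _ ->]; rewrite !inE /=.
  have cst y : linked C x y -> i x = i y.
    case/connectP=> p + ->; elim: p x => //= y' p IHp x /andP[xy' /IHp <-].
    by case/orP: xy' => /iC.
  by move=> /cst <- /cst <-.
move=> iC; split=> // -[a b] /linked_edge ab /=.
apply: (iC [set y in [set: 'I_n] | linked C a y]%SET); rewrite ?inE ?connect0 //.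
by apply: imset_f; rewrite inE.
Qed.

Lemma constrained_series_word {n : nat} (A C : seq ('I_n * 'I_n))
    (i : {ffun 'I_n -> nat}) :
  constrained_series A C (tuple_word i) = `[< edge_constraints A C i >]%:R.
Proof.
rewrite /constrained_series ncsumE; last exact: tuple_word_inj.
congr (_%:R); congr nat_of_bool; apply: asbool_equiv_eq.
by split=> [[j jP /tuple_word_inj <-]|iP] //; exists i.
Qed.

(** The words allowed by [A] and [C] split according to whether the letters at the two ends of [a]
    differ or agree. *)
Lemma constrained_series_cons {n : nat} (a : 'I_n * 'I_n) (A C : seq ('I_n * 'I_n)) :
  constrained_series (a :: A) C =
  constrained_series A C - constrained_series A (a :: C).
Proof.
apply/funext=> w.
change (constrained_series (a :: A) C w =
        constrained_series A C w - constrained_series A (a :: C) w).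
have [[i <-]|nw] := pselect (exists i : {ffun 'I_n -> nat}, tuple_word i = w).
  rewrite !constrained_series_word.
  have -> : `[< edge_constraints (a :: A) C i >] =
            `[< edge_constraints A C i >] && (i a.1 != i a.2).
    apply/asboolP/andP => [[iA iC]|[/asboolP[iA iC] /eqP ia]].
      split; last by apply/eqP/iA; rewrite inE eqxx.
      by apply/asboolP; split=> // b bA; apply: iA; rewrite inE bA orbT.
    by split=> // b; rewrite inE => /predU1P[->|/iA].
  have -> : `[< edge_constraints A (a :: C) i >] =
            `[< edge_constraints A C i >] && (i a.1 == i a.2).
    apply/asboolP/andP => [[iA iC]|[/asboolP[iA iC] /eqP ia]].
      split; last by apply/eqP/iC; rewrite inE eqxx.
      by apply/asboolP; split=> // b bC; apply: iC; rewrite inE bC orbT.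
    by split=> // b; rewrite inE => /predU1P[->|/iC].
  by case: `[< _ >]; case: eqP; rewrite ?subrr ?subr0.
(* A word that comes from no tuple has coefficient 0 in all three series. *)
have series0 (A' C' : seq ('I_n * 'I_n)) : constrained_series A' C' w = 0.
  rewrite /constrained_series ncsumE; last exact: tuple_word_inj.
  by case: asboolP => // -[i _ iw]; case: nw; exists i.
by rewrite !series0 subrr.
Qed.

(** Both sides obey the same recursion on [A]; for empty [A], [ncp_sum] sums over the partitions
    below the components of [C]. *)
Lemma constrained_series_expansion {n : nat} (A C : seq ('I_n * 'I_n)) :
  constrained_series A C =
  \sum_(P : setpart n) chrom_coef (same_block P) A C *: ncx P.
Proof.
elim: A C => [|a A IHA] C /=.
  rewrite constrained_series_nil ncp_sum big_mkcond; apply: eq_bigr => P _.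
  by rewrite le_linked_setpart; case: joins; rewrite ?scale1r ?scale0r.
rewrite constrained_series_cons !IHA -sumrB; apply: eq_bigr => P _.
by rewrite scalerBl.
Qed.

(** * From vertices to labels, and the final signs *)

Lemma Y_constrained_series {n : nat} {V : finType} {e : rel V} {v : 'I_n -> V}
    {A : seq ('I_n * 'I_n)} :
  bijective v -> (forall i j, ((i, j) \in A) = e (v i) (v j)) ->
  Y e v = constrained_series A [::].
Proof.
move=> v_bij AE; apply/funext=> w.
rewrite /Y /constrained_series !ncsumE; [|exact: tuple_word_inj|exact: colour_word_inj].
congr (_%:R); congr nat_of_bool; apply: asbool_equiv_eq.
have [g vK gK] := v_bij.
split=> [[k kP <-]|[i [iA _] <-]].
  exists [ffun j => k (v j)]; last by apply: eq_map => j; rewrite ffunE.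
  by split=> // -[a b]; rewrite AE !ffunE => /kP.
exists [ffun x => i (g x)]; last by apply: eq_map => j; rewrite ffunE vK.
move=> a b eab; rewrite !ffunE; apply: (iA (g a, g b)).
by rewrite AE !gK.
Qed.

Lemma n_comp_preim {n : nat} {V : finType} {e : rel V} {v : 'I_n -> V}
    {A : seq ('I_n * 'I_n)} :
  symmetric e -> bijective v -> (forall i j, ((i, j) \in A) = e (v i) (v j)) ->
  n_comp e V = n_comp (edge_rel A) 'I_n.
Proof.
move=> e_sym v_bij AE.
have [g vK gK] := v_bij.
rewrite (adjunction_n_comp v (e' := edge_rel A)) //.
- exact: sym_connect_sym.
- exact: linked_sym.
apply: strict_adjunction => //.
- exact: linked_sym.
- exact: bij_inj.
- by apply/fintype.subsetP=> x _; apply/codomP; exists (g x).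
by move=> x y _; rewrite /edge_rel !AE (e_sym (v y)) orbb.
Qed.

Theorem theorem4p8 (n : nat) (n_gt0 : (0 < n)%N)
    (V : finType) (e : rel V) (e_sym : symmetric e) (e_irr : irreflexive e)
    (v : 'I_n -> V) (v_bij : bijective v) :
  (connected_graph e ->
     exists Z : ncseries, Y e v = (-1) ^+ (n - 1) *: Z /\ x_positive n Z)
  /\
  (forall k : nat, n_comp e V = k ->
     (exists Z : ncseries, Y e v = (-1) ^+ (n - k) *: Z /\ x_positive n Z)
     /\ (~~ odd (n - k) -> x_positive n (Y e v))
     /\ (odd (n - k) -> x_negative n (Y e v))).
Proof.
(* Each edge is listed in both orientations; the second one only repeats a constraint. *)
pose A := [seq ij <- enum {: 'I_n * 'I_n} | e (v ij.1) (v ij.2)].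
have AE i j : ((i, j) \in A) = e (v i) (v j) by rewrite mem_filter mem_enum andbT.
set k := n_comp e V.
have ncA : k = n_comp (edge_rel A) 'I_n := n_comp_preim e_sym v_bij AE.
have k_le_n : (k <= n)%N.
  by rewrite ncA -[leqRHS]card_ord; apply: max_card.
have nc0 : n_comp (edge_rel (Nil ('I_n * 'I_n))) 'I_n = n.
  by rewrite n_comp_nil card_ord.
pose c (P : setpart n) := chrom_coef (same_block P) A [::].
have c_sign P : 0 <= (-1) ^+ (n - k) * c P.
  (* With no equality constraint there are [n] components, so the exponent is [n + k], of the same
     parity as [n - k] because [k <= n]. *)
  have := chrom_coef_sign (same_block P) A [::].
  by rewrite cats0 nc0 -ncA -signr_odd oddD -oddB // signr_odd.
have YE : Y e v = \sum_P c P *: ncx P.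
  by rewrite (Y_constrained_series v_bij AE) constrained_series_expansion.
have Z_pos : exists Z : ncseries, Y e v = (-1) ^+ (n - k) *: Z /\ x_positive n Z.
  exists ((-1) ^+ (n - k) *: Y e v); split.
    by rewrite scalerA -expr2 sqrr_sign scale1r.
  exists (fun P => (-1) ^+ (n - k) * c P); split=> //.
  by rewrite YE scaler_sumr; apply: eq_bigr => P _; rewrite scalerA.
split=> [[V_gt0 e_conn]|_ <-].
  suff <- : k = 1%N by [].
  case/card_gt0P: V_gt0 => x _.
  rewrite -(n_comp_connect (sym_connect_sym e_sym) x); apply: eq_n_comp_r => y.
  by rewrite !inE e_conn.
split=> //; split=> odd_nk; exists c; split=> // P; have := c_sign P;
  rewrite -signr_odd ?odd_nk ?(negPf odd_nk) ?mul1r //.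
by rewrite expr1 mulN1r oppr_ge0.
Qed.
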